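(* Let $G$ be a connected finite simple graph. Then $sn(G)=|G|-1$ if, and only if, $G$ is a complete graph.
   Context: Graphs are finite and simple; $|G|$ denotes the number of vertices of $G$; a connected graph has at least one vertex. All colourings are vertex-colourings. $\chi(G)$ is the chromatic number of $G$, and a $\chi(G)$-colouring uses colours from the fixed set $[\chi(G)]=\{1,\dots,\chi(G)\}$. A partial proper $\chi(G)$-colouring of $G$ is an assignment of colours from $[\chi(G)]$ to the vertices of some subset of $V(G)$ such that no two adjacent coloured vertices have the same colour. A colouring $\phi$ extends a partial colouring $\psi$ if every vertex coloured in $\psi$ receives the same colour in $\phi$. A Sudoku colouring of $G$ is a partial proper $\chi(G)$-colouring of $G$ which has precisely one extension to a proper $\chi(G)$-colouring of all the vertices of $G$. The Sudoku number $sn(G)$ is the smallest number of coloured vertices in a Sudoku colouring of $G$. *)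

(* Defs.v *)
From mathcomp Require Import all_boot.

Set Implicit Arguments.
Unset Strict Implicit.
Unset Printing Implicit Defensive.

Record sgraph := SGraph {
  vertex :> finType;
  adj : rel vertex;
  adj_sym : symmetric adj;
  adj_irrefl : irreflexive adj }.

Definition connected_graph (G : sgraph) : Prop :=
  0 < #|G| /\ forall x y : G, connect (@adj G) x y.

Definition complete_graph (G : sgraph) : Prop :=
  forall x y : G, x != y -> adj x y.

(* The palette {1, ..., k} is represented by 'I_k = {0, ..., k - 1}. *)
Definition proper_coloring (G : sgraph) (k : nat) (phi : {ffun G -> 'I_k}) :
    bool :=
  [forall x, forall y, adj x y ==> (phi x != phi y)].

Definition colorable (G : sgraph) (k : nat) : bool :=
  [exists phi : {ffun G -> 'I_k}, proper_coloring phi].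

Lemma ex_colorable (G : sgraph) : exists k, colorable G k.
Proof.
exists #|G|; apply/existsP; exists [ffun x => enum_rank x].
apply/forallP => x; apply/forallP => y; apply/implyP => xy.
rewrite !ffunE (inj_eq enum_rank_inj).
by apply/eqP => exy; rewrite exy adj_irrefl in xy.
Qed.

Definition chi (G : sgraph) : nat := ex_minn (ex_colorable G).

(* In a partial colouring, None marks an uncoloured vertex. *)
Definition colored (G : sgraph) (k : nat) (psi : {ffun G -> option 'I_k}) :
    {set G} :=
  [set x | psi x != None].

Definition partial_proper_coloring (G : sgraph) (k : nat)
    (psi : {ffun G -> option 'I_k}) : bool :=
  [forall x in colored psi, forall y in colored psi,
     adj x y ==> (psi x != psi y)].

Definition extends (G : sgraph) (k : nat) (phi : {ffun G -> 'I_k})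
    (psi : {ffun G -> option 'I_k}) : bool :=
  [forall x in colored psi, psi x == Some (phi x)].

Definition sudoku_coloring (G : sgraph)
    (psi : {ffun G -> option 'I_(chi G)}) : bool :=
  partial_proper_coloring psi &&
  (#|[set phi : {ffun G -> 'I_(chi G)} |
       proper_coloring phi && extends phi psi]| == 1).

Definition has_sudoku_coloring (G : sgraph) (n : nat) : bool :=
  [exists psi : {ffun G -> option 'I_(chi G)},
     sudoku_coloring psi && (#|colored psi| == n)].

Lemma ex_sudoku_coloring (G : sgraph) : exists n, has_sudoku_coloring G n.
Proof.
have /existsP[phi phiP] : colorable G (chi G) by rewrite /chi; case: ex_minnP.
pose psi : {ffun G -> option 'I_(chi G)} := [ffun x => Some (phi x)].
exists #|colored psi|; apply/existsP; exists psi; rewrite eqxx andbT.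
apply/andP; split.
  apply/forall_inP => x _; apply/forall_inP => y _; apply/implyP => xy.
  rewrite !ffunE; apply/eqP => -[exy].
  by move/forallP: phiP => /(_ x) /forallP /(_ y); rewrite xy exy eqxx.
apply/cards1P; exists phi; apply/setP => phi'; rewrite !inE.
apply/andP/eqP => [[_ /forall_inP ext]|->]; last first.
  by split=> //; apply/forall_inP => x _; rewrite ffunE.
apply/ffunP => x; have := ext x; rewrite inE !ffunE => /(_ isT) /eqP [->] //.
Qed.

Definition sn (G : sgraph) : nat := ex_minn (ex_sudoku_coloring G).

(* Main.v *)
(* Call a vertex dominating for a colouring if it sees every colour but its own.
   In a [chi G]-colouring every colour class contains a dominating vertex: otherwise
   that class could be recoloured with the other colours.  Uncolouring two dominating
   vertices [u] and [v] leaves a Sudoku colouring, unless [v] is the only neighbour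
   of [u] with its colour.  So if [sn G = #|G| - 1], the dominating vertices form
   a clique closed under adjacency, which is all of [G] by connectedness. *)
Require Import Defs.
From mathcomp Require Import all_boot perm.

Set Implicit Arguments.
Unset Strict Implicit.
Unset Printing Implicit Defensive.

Section Coloring.
Variables (G : sgraph) (k : nat).
Implicit Types phi : {ffun G -> 'I_k}.

Lemma proper_coloringP phi :
  reflect (forall x y, adj x y -> phi x != phi y) (proper_coloring phi).
Proof.
apply: (iffP forallP) => [phiP x y|phiP x].
  by move/forallP: (phiP x) => /(_ y)/implyP.
by apply/forallP => y; apply/implyP/phiP.
Qed.

Lemma inj_proper_coloring phi : injective phi -> proper_coloring phi.
Proof.
move=> phi_inj; apply/proper_coloringP => x y xy.
by rewrite (inj_eq phi_inj); apply: contraTneq xy => ->; rewrite adj_irrefl.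
Qed.

Lemma complete_coloring_inj phi :
  complete_graph G -> proper_coloring phi -> injective phi.
Proof.
move=> complG /proper_coloringP phiP x y /eqP; apply: contraTeq.
by move=> /complG/phiP.
Qed.

Definition dominating phi (u : G) : bool :=
  [forall c, (c != phi u) ==> [exists w, adj u w && (phi w == c)]].

Lemma dominatingP phi u :
  reflect (forall c, c != phi u -> exists2 w, adj u w & phi w = c)
          (dominating phi u).
Proof.
apply: (iffP forallP) => [domP c|domP c].
  move/implyP: (domP c) => domc /domc/existsP[w /andP[uw /eqP wc]].
  by exists w.
apply/implyP => /domP[w uw wc]; apply/existsP; exists w.
by rewrite uw wc eqxx.
Qed.

(** For a proper [phi], this says that the restriction of [phi] to [A] is a Sudoku colouring,
    without mentioning partial colourings. *)
Definition determining phi (A : {set G}) : Prop :=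
  forall phi', proper_coloring phi' -> {in A, phi' =1 phi} -> phi' = phi.

(** The two vertices are forced in order. First [u]: every other colour sits on a coloured neighbour
    distinct from [v]. Then [v], all of whose neighbours now have their colours from [phi]. *)
Lemma determining_setC2 phi (u v : G) :
    (forall c, c != phi u -> exists2 w, adj u w && (w != v) & phi w = c) ->
    dominating phi v ->
  determining phi (~: [set u; v]).
Proof.
move=> domu /dominatingP domv phi' /proper_coloringP phiP' eqA.
have eqN x : x != u -> x != v -> phi' x = phi x.
  by move=> xu xv; apply: eqA; rewrite !inE negb_or xu.
have equ : phi' u = phi u.
  apply/eqP/negPn/negP => /domu[w /andP[uw wv] wc].
  have := phiP' _ _ uw; rewrite (eqN w) ?wc ?eqxx //.
  by apply: contraTneq uw => ->; rewrite adj_irrefl.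
have eqNv x : x != v -> phi' x = phi x.
  by move=> xv; have [->|xu] := eqVneq x u; last exact: eqN.
apply/ffunP => x; have [->|] := eqVneq x v; last exact: eqNv.
apply/eqP/negPn/negP => /domv[w vw wc].
have := phiP' _ _ vw; rewrite (eqNv w) ?wc ?eqxx //.
by apply: contraTneq vw => ->; rewrite adj_irrefl.
Qed.

End Coloring.

Section Sudoku.
Variable G : sgraph.
Implicit Types phi : {ffun G -> 'I_(chi G)}.

Lemma chi_colorable : colorable G (chi G).
Proof. by rewrite /chi; case: ex_minnP. Qed.

Lemma chi_le k (phi : {ffun G -> 'I_k}) : proper_coloring phi -> chi G <= k.
Proof.
by move=> phiP; rewrite /chi; case: ex_minnP => m _; apply; apply/existsP; exists phi.
Qed.

Lemma chi_le_card : chi G <= #|G|.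
Proof.
apply: (@chi_le _ [ffun x : G => enum_rank x]); apply: inj_proper_coloring.
by move=> x y; rewrite !ffunE => /enum_rank_inj.
Qed.

Lemma sn_le phi (A : {set G}) :
  proper_coloring phi -> determining phi A -> sn G <= #|A|.
Proof.
move=> phiP detA; rewrite /sn; case: ex_minnP => m _; apply.
pose psi := [ffun x => if x \in A then Some (phi x) else None].
have colP x : (x \in colored psi) = (x \in A).
  by rewrite inE ffunE; case: (x \in A).
apply/existsP; exists psi; rewrite (eq_card colP) eqxx andbT.
apply/andP; split.
  apply/forall_inP => x; rewrite colP => xA; apply/forall_inP => y.
  rewrite colP => yA; apply/implyP => xy; rewrite !ffunE xA yA.
  by move/proper_coloringP: phiP => /(_ _ _ xy); apply: contraNneq => -[->].
apply/cards1P; exists phi; apply/setP => phi'; rewrite !inE.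
apply/andP/eqP => [[phiP' /forall_inP ext]|->].
  apply: detA => // x xA; have := ext x; rewrite colP ffunE xA.
  by move=> /(_ isT)/eqP[].
by split=> //; apply/forall_inP => x; rewrite colP ffunE => ->.
Qed.

(** Take a smallest Sudoku colouring: [phi] is its only extension and [A] its set of coloured
    vertices. *)
Lemma sn_witness : exists phi (A : {set G}),
  [/\ proper_coloring phi, determining phi A & #|A| = sn G].
Proof.
rewrite /sn; case: ex_minnP => m /existsP[psi /andP[/andP[_ /cards1P[phi]]]].
move=> /setP extE /eqP cardA _; have := extE phi; rewrite !inE eqxx.
move=> /andP[phiP /forall_inP extP]; exists phi, (colored psi); split=> //.
move=> phi' phiP' eqA; apply/eqP; rewrite -in_set1 -extE inE phiP'.
by apply/forall_inP => x xA; rewrite eqA //; apply: extP.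
Qed.

Lemma dominating_color_class phi (c : 'I_(chi G)) :
  proper_coloring phi -> exists2 u, phi u = c & dominating phi u.
Proof.
move=> /proper_coloringP phiP.
case: (pickP [pred u | (phi u == c) && dominating phi u]).
  by move=> u /andP[/eqP uc domu]; exists u.
move=> nodom.
(* A vertex of the class [c] is not dominating, so some colour other than [c] is absent from its
   neighbours; any other vertex keeps its colour. The sigma type lets these choices form the
   function [f]. *)
have recolor u : {d | d != c & forall w, adj u w -> phi w != c -> phi w != d}.
  have [uc|uc] := eqVneq (phi u) c; last first.
    by exists (phi u) => // w uw _; rewrite eq_sym phiP.
  case: (pickP [pred d | (d != c) && [forall w, adj u w ==> (phi w != d)]]).
    move=> d /andP[dc /forallP dP]; exists d => // w uw _.
    exact: (implyP (dP w)).
  move=> nod; have /negP[] := negbT (nodom u); rewrite /= uc eqxx /=.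
  apply/dominatingP => d; rewrite uc => dc; have := nod d; rewrite /= dc /=.
  move=> /negbT; rewrite negb_forall => /existsP[w].
  by rewrite negb_imply negbK => /andP[uw /eqP]; exists w.
pose f u := if phi u == c then s2val (recolor u) else phi u.
have fc u : f u != c.
  by rewrite /f; case: ifP => [_|->//]; case: (recolor u).
have fP u w : adj u w -> f u != f w.
  move=> uw; rewrite /f; case: ifPn => uc; case: ifPn => wc.
  (* Colour classes are independent, so two adjacent vertices are never recoloured at once. *)
  - by have := phiP _ _ uw; rewrite (eqP uc) (eqP wc) eqxx.
  - by case: (recolor u) => d /= _ dP; rewrite eq_sym dP.
  - by case: (recolor w) => d /= _ dP; rewrite dP // adj_sym.
  - exact: phiP.
have : proper_coloring [ffun u => enum_rank (exist _ (f u) (fc u) : {d | d != c})].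
  apply/proper_coloringP => u w uw; rewrite !ffunE (inj_eq enum_rank_inj).
  by rewrite -val_eqE /= fP.
move=> /chi_le; rewrite card_sig (cardC1 c) card_ord.
(* The colour [c] itself shows [0 < chi G], so the palette without [c] is strictly smaller than
   [chi G]. *)
by rewrite leqNgt ltn_predL (leq_ltn_trans (leq0n c) (ltn_ord c)).
Qed.

Lemma sn_complete : complete_graph G -> 0 < #|G| -> sn G = #|G| - 1.
Proof.
move=> complG /card_gt0P[x0 _]; apply/eqP; rewrite eqn_leq; apply/andP; split.
  have /existsP[phi phiP] := chi_colorable.
  have inj := complete_coloring_inj complG.
  rewrite subn1 -(cardsC1 x0); apply: (sn_le phiP) => phi' phiP' eqA.
  have eqN x : x != x0 -> phi' x = phi x by move=> xx0; apply: eqA; rewrite !inE.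
  apply/ffunP => x; have [->|] := eqVneq x x0; last exact: eqN.
  (* The injective [phi] is onto, as there are at most [#|G|] colours. Were [y] different from [x0],
     then [phi'] would repeat the colour of [y] at [x0]. *)
  have /codomP[y yE] : phi' x0 \in codom phi.
    by apply: inj_card_onto; [apply: inj | rewrite card_ord chi_le_card].
  have [eyx|yx0] := eqVneq y x0; first by rewrite yE eyx.
  move: yE; rewrite -(eqN y) // => /(inj _ _ phiP') x0y.
  by rewrite x0y eqxx in yx0.
have [phi [A [phiP detA <-]]] := sn_witness.
rewrite leqNgt; apply/negP => ltA.
have /card_gt1P[u [v [uA vA uv]]] : 1 < #|~: A|.
  by rewrite cardsCs setCK ltn_subRL addnC -ltn_subRL.
have inj := complete_coloring_inj complG phiP.
(* Swapping the colours of two uncoloured vertices gives another proper extension, which contradicts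
   uniqueness. *)
have eqphi : [ffun x => phi (tperm u v x)] = phi.
  apply: detA => [|x xA].
    by apply: inj_proper_coloring => x y; rewrite !ffunE => /inj/perm_inj.
  by rewrite ffunE tpermD //; [move: uA | move: vA]; rewrite inE;
    apply: contraNneq => ->.
have := ffunE (fun x => phi (tperm u v x)) u.
by rewrite eqphi tpermL => /inj uvE; rewrite uvE eqxx in uv.
Qed.

Lemma dominating_unique_neighbor phi (u v : G) :
    sn G = #|G| - 1 -> proper_coloring phi -> u != v ->
    dominating phi u -> dominating phi v ->
  adj u v /\ (forall w, adj u w -> phi w = phi v -> w = v).
Proof.
move=> snG phiP uv /dominatingP domu domv.
have notdet : ~ determining phi (~: [set u; v]).
  move=> /(sn_le phiP); rewrite snG cardsCs setCK cards2 uv leqNgt.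
  (* Subtraction is truncated: [#|G| - 2 < #|G| - 1] needs at least two vertices. *)
  have : 1 < #|G| by apply/card_gt1P; exists u, v.
  by case: #|G| => [|[|n]] //= _; rewrite !subSS !subn0 ltnSn.
split.
  apply/negPn/negP => uvN; apply: notdet; apply: determining_setC2 => // c.
  move=> /domu[w uw wc]; exists w => //; rewrite uw /=.
  by apply: contraNneq uvN => <-.
move=> w uw wv; apply/eqP/negPn/negP => neq; apply: notdet.
apply: determining_setC2 => // c /domu[w' uw' wc'].
(* The second neighbour [w] shows [u] the colour of [v] once [v] is uncoloured. *)
have [ew|nw] := eqVneq w' v; last by exists w' => //; rewrite uw'.
by exists w; rewrite ?uw // wv -ew.
Qed.

Lemma complete_of_sn :
  connected_graph G -> sn G = #|G| - 1 -> complete_graph G.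
Proof.
move=> [/card_gt0P[x0 _] connG] snG.
have /existsP[phi phiP] := chi_colorable.
have step u w : dominating phi u -> adj u w -> dominating phi w.
  (* The class of [w] has a dominating vertex [v]; as [v] is the only neighbour of [u] with that
     colour, [w] is [v]. *)
  move=> domu uw; have [v vw domv] := dominating_color_class (phi w) phiP.
  have uv : u != v.
    by move/proper_coloringP: phiP => /(_ _ _ uw); apply: contraNneq => ->; rewrite vw.
  have [_ uniq] := dominating_unique_neighbor snG phiP uv domu domv.
  by rewrite (uniq w).
have [u0 _ domu0] := dominating_color_class (phi x0) phiP.
have dom x : dominating phi x.
  have /connectP[p] := connG u0 x.
  elim: p u0 domu0 => [|y p IHp] u domu /= => [_ ->//|/andP[uy /IHp]].
  by apply; apply: step uy.
by move=> x y xy; have [] := dominating_unique_neighbor snG phiP xy (dom x) (dom y).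
Qed.

End Sudoku.

Theorem theorem2 (G : sgraph) (connG : connected_graph G) :
  sn G = #|G| - 1 <-> complete_graph G.
Proof.
split; first exact: complete_of_sn.
by move=> complG; case: connG => G_gt0 _; apply: sn_complete.
Qed.
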